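(* Let $G=(V,E)$ be a finite simple graph and let $\chi_G(x,y)$ be its bivariate chromatic polynomial. Then for all integers $x \ge 1$ and $0 \le y \le x$, \[ \chi_G(-x,-y) \;=\; \sum_{H \text{ flat of } G} (-1)^{|V(H)|}\, m_H(\sigma,c), \] where $m_H(\sigma,c)$ denotes the number of pairs $(\sigma,c)$ consisting of an acyclic orientation $\sigma$ of $H$ and a coloring $c : V(H) \to [x]$ compatible with $\sigma$ such that $c(v) > y$ for every $v \in C(H)$.
   Context: For a positive integer $x$, $[x]=\{1,\dots,x\}$. For integers $x\ge 1$, $0 \le y \le x$, $\chi_G(x,y)$ is the number of colorings $c : V \to [x]$ such that for every edge $vw \in E$, either $c(v) \ne c(w)$ or $c(v)=c(w) > y$. This counting function is given by a polynomial in $x$ and $y$, the bivariate chromatic polynomial, and $\chi_G(-x,-y)$ denotes the evaluation of this polynomial at $(-x,-y)$. A flat of $G$ is a graph $H$ that can be constructed from $G$ by a (possibly empty) series of edge contractions. Flats are identified by the vertex partition they induce: flats $H$ of $G$ correspond bijectively to partitions of $V$ into nonempty blocks each inducing a connected subgraph of $G$; the vertex set $V(H)$ is the set of blocks, and two distinct blocks are adjacent in $H$ iff some edge of $G$ joins them (no loops, parallel edges merged). $C(H) \subseteq V(H)$ is the set of vertices of $H$ that resulted from contractions, i.e. the blocks with at least two elements. An orientation $\sigma$ of $H$ and a coloring $c: V(H)\to[x]$ are compatible if $c(v) \le c(w)$ for every edge of $H$ oriented from $v$ to $w$. An orientation is acyclic if it has no directed cycle. *)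

(* Defs.v *)
From mathcomp Require Import all_boot all_order all_algebra.
From mathcomp Require Import polyXY.
Set Implicit Arguments. Unset Strict Implicit. Unset Printing Implicit Defensive.
Import GRing.Theory.

Record sgraph := SGraph {
  vertex :> finType;
  adj : rel vertex;
  adj_sym : symmetric adj;
  adj_irr : irreflexive adj }.
Arguments adj {s} v w : rename.

(* The colour set [x] = {1, ..., x} is encoded by 'I_x, whose values start
   at 0; colours are always compared through [color]. *)
Definition color (x : nat) (i : 'I_x) : nat := i.+1.

Definition bicoloring (G : sgraph) (x y : nat) (c : {ffun G -> 'I_x}) : bool :=
  [forall v : G, forall w : G, adj v w ==>
    (color (c v) != color (c w))
    || (color (c v) == color (c w)) && (y < color (c v))].

Definition num_bicolorings (G : sgraph) (x y : nat) : nat :=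
  #|[set c : {ffun G -> 'I_x} | bicoloring y c]|.

(* The outer indeterminate of a [{poly {poly int}}] is x and the inner one is
   y: [p.[a, b]] is the value at x = a, y = b. *)
Definition counts_bicolorings (G : sgraph) (p : {poly {poly int}}) : Prop :=
  forall x y : nat, 0 < x -> y <= x ->
    p.[x%:Z, y%:Z]%R = (num_bicolorings G x y)%:Z%R.

Section Existence.
Variable V : finType.
Implicit Types (A S : seq (V * V)).

Let bad (x y : nat) (c : {ffun V -> 'I_x}) (e : V * V) : bool :=
  (c e.1 == c e.2) && (c e.1 < y).

Let touched A (v : V) := has (fun e => (v == e.1) || (v == e.2)) A.
Let link A : rel V := [rel u v | ((u, v) \in A) || ((v, u) \in A)].

Let link_sym A : connect_sym (link A).
Proof. by apply: sym_connect_sym => u v; rewrite /link /= orbC. Qed.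

Let link_touched A u v : link A u v -> touched A u && touched A v.
Proof.
by case/orP => h; apply/andP; split; apply/hasP;
  [exists (u, v) | exists (u, v) | exists (v, u) | exists (v, u)];
  rewrite //= eqxx ?orbT.
Qed.

Let touched_connect A u v : connect (link A) u v -> touched A u = touched A v.
Proof.
case/connectP => p + ->; elim: p u => [//|w p IH] u /= /andP [uw wp].
by rewrite -(IH w wp); case/andP: (link_touched uw) => -> ->.
Qed.

Let num_all_bad A : {p : {poly {poly int}} | forall x y, 0 < x -> y <= x ->
  p.[x%:Z, y%:Z]%R = #|[set c : {ffun V -> 'I_x} | all (bad y c) A]|%:Z%R}.
Proof.
pose e := link A; have esym := link_sym A.
exists (\prod_(v : V) (if ~~ roots e v then 1 else
                       if touched A v then 'X%:P else 'X))%R.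
case=> [//|x] y _ yx.
pose F (v : V) : pred 'I_x.+1 := fun i =>
  if ~~ roots e v then i == ord0 else if touched A v then (i < y)%N else true.
transitivity (#|family F|%:Z%R); last first.
  congr (Posz _).
  pose ext (d : {ffun V -> 'I_x.+1}) := [ffun v => d (fingraph.root e v)].
  rewrite -(@card_in_imset _ _ ext (family F)); last first.
    move=> d1 d2 /familyP h1 /familyP h2 /ffunP h; apply/ffunP => v.
    have [rv | nrv] := boolP (roots e v).
      by have := h v; rewrite !ffunE (eqP rv).
    have := h1 v; have := h2 v; rewrite !unfold_in nrv.
    by move=> /eqP -> /eqP ->.
  apply/eq_card => c; rewrite [RHS]inE; apply/imsetP/idP => [[d /familyP dF ->] | cA].
    apply/allP => -[u v] uvA.
    have uv : link A u v by rewrite /link /= uvA.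
    rewrite /bad /= !ffunE.
    have -> : fingraph.root e u = fingraph.root e v by apply/(fingraph.rootP esym); apply: connect1.
    rewrite eqxx /=.
    have := dF (fingraph.root e v); rewrite !unfold_in (roots_root esym) /=.
    rewrite -(touched_connect (connect_root e v)).
    by case/andP: (link_touched uv) => _ ->.
  have cl u v : link A u v -> c u = c v.
    by case/orP => /(allP cA) /andP [] /eqP.
  have cc u v : connect e u v -> c u = c v.
    case/connectP => p + ->; elim: p u => [//|w p IH] u /= /andP [uw wp].
    by rewrite (cl _ _ uw) (IH w wp).
  exists [ffun v => if roots e v then c v else ord0]; last first.
    apply/ffunP => v; rewrite !ffunE (roots_root esym).
    exact/cc/connect_root.
  apply/familyP => v; rewrite !unfold_in ffunE; case: (roots e v) => //=.
  case tv: (touched A v) => //.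
  case/hasP: tv => -[a b] abA /=; have /andP [/eqP /= E /= lt] := allP cA _ abA.
  by case/orP => /eqP ->; rewrite // -E.
rewrite card_family foldrE big_map big_enum /=.
rewrite (big_morph Posz PoszM (erefl _)) !horner_prod; apply: eq_bigr => v _.
rewrite /F; case: (roots e v) => /=; last first.
  by rewrite !hornerE (eq_card1 (x := ord0)).
case: (touched A v); rewrite !hornerE ?cardT ?size_enum_ord //.
  congr (Posz _); rewrite -sum1_card.
  have {1}-> : y = \sum_(0 <= i < y) 1 by rewrite sum_nat_const_nat subn0 muln1.
  by rewrite (big_nat_widen _ _ x.+1) // big_mkord.
Qed.

Let num_bad_good S : forall A, {p : {poly {poly int}} |
  forall x y, 0 < x -> y <= x -> p.[x%:Z, y%:Z]%R =
    #|[set c : {ffun V -> 'I_x} |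
        all (bad y c) A && all (predC (bad y c)) S]|%:Z%R}.
Proof.
elim: S => [|e S IH] A.
  have [p Hp] := num_all_bad A; exists p => x y x0 yx.
  by rewrite Hp //; congr Posz; apply: eq_card => c; rewrite !inE andbT.
have [[p Hp] [q Hq]] := (IH A, IH (e :: A)).
exists (p - q)%R => x y x0 yx; rewrite !hornerE Hp // Hq //.
apply/eqP; rewrite subr_eq -PoszD; apply/eqP; congr Posz.
rewrite -cardsUI.
rewrite [X in _ = _ + X]eq_card0 ?addn0; last first.
  by move=> c; rewrite !inE /=; case: (bad y c e); rewrite /= ?andbF.
apply: eq_card => c; rewrite !inE /=.
by case: (bad y c e); case: all; case: all.
Qed.

Lemma num_good_poly S : {p : {poly {poly int}} |
  forall x y, 0 < x -> y <= x -> p.[x%:Z, y%:Z]%R =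
    #|[set c : {ffun V -> 'I_x} |
       all (fun e => ~~ ((c e.1 == c e.2) && (c e.1 < y)%N)) S]|%:Z%R}.
Proof. exact: num_bad_good S [::]. Qed.

End Existence.

Lemma bichrom_poly_exists (G : sgraph) :
  {p : {poly {poly int}} | counts_bicolorings G p}.
Proof.
have [p Hp] := num_good_poly [seq e <- enum {: G * G} | adj e.1 e.2].
exists p => x y x0 yx; rewrite Hp //; congr Posz; apply: eq_card => c.
rewrite !inE all_filter; apply/allP/forallP => [h v | h [v w] _ /=].
  apply/forallP => w; have := h (v, w); rewrite mem_enum => /(_ isT) /=.
  rewrite /color eqSS -val_eqE /=.
  by case: (adj v w) => //=; case: eqP => //= _; rewrite -leqNgt ltnS.
have /forallP/(_ w) := h v; rewrite /color eqSS -val_eqE /=.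
by case: (adj v w) => //=; case: eqP => //= _; rewrite -leqNgt ltnS.
Qed.

Lemma poly_nat_roots (R : idomainType) (f : nat -> R) (p : {poly R}) (m : nat) :
  injective f -> (forall n, m <= n -> p.[f n]%R = 0%R) -> p = 0%R.
Proof.
move=> finj h; apply/eqP; apply: contraT => p0.
have := max_poly_roots p0 (rs := [seq f n | n <- iota m (size p)]).
rewrite map_inj_uniq ?iota_uniq // size_map size_iota ltnn => -> //.
apply/allP => _ /mapP [n + ->]; rewrite mem_iota => /andP [mn _].
by apply/rootP/h.
Qed.

Lemma counts_bicolorings_uniq (G : sgraph) (p q : {poly {poly int}}) :
  counts_bicolorings G p -> counts_bicolorings G q -> p = q.
Proof.
move=> hp hq; apply/eqP; rewrite -subr_eq0 -swapXY_eq0; apply/eqP.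
apply: (@poly_nat_roots _ (fun y => (y%:Z)%:P)%R _ 0) => [y y' /polyC_inj [] //|y _].
apply: (@poly_nat_roots _ (fun x => x%:Z)%R _ y.+1) => [x x' [] //|x yx].
rewrite horner2_swapXY !hornerE hp ?hq ?subrr //; try exact: ltnW.
all: exact: leq_trans yx.
Qed.

Definition bichrom_poly (G : sgraph) : {poly {poly int}} :=
  sval (bichrom_poly_exists G).

Lemma bichrom_polyP (G : sgraph) : counts_bicolorings G (bichrom_poly G).
Proof. exact: svalP (bichrom_poly_exists G). Qed.

Section Flats.
Variable G : sgraph.
Implicit Types (B C : {set G}) (P Q : {set {set G}}).

Definition block_adj B C : bool :=
  (B != C) && [exists v in B, exists w in C, adj v w].

Definition singletons : {set {set G}} := [set [set v] | v : G].

(* Contracting an edge of the graph on the blocks of [P] merges its two ends. *)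
Definition edge_contraction : rel {set {set G}} := fun P Q =>
  [exists B in P, exists C in P,
    block_adj B C && (Q == (B :|: C) |: (P :\: [set B; C]))].

Definition flat P : bool := connect edge_contraction singletons P.

Lemma block_adj_sym P :
  symmetric (fun B C : {B : {set G} | B \in P} => block_adj (val B) (val C)).
Proof.
move=> B C; rewrite /block_adj eq_sym; congr (_ && _).
by apply/exists_inP/exists_inP => -[v vB /exists_inP [w wC vw]];
  exists w => //; apply/exists_inP; exists v; rewrite // adj_sym.
Qed.

Lemma block_adj_irr P :
  irreflexive (fun B C : {B : {set G} | B \in P} => block_adj (val B) (val C)).
Proof. by move=> B; rewrite /block_adj eqxx. Qed.

Definition flat_graph P : sgraph :=
  SGraph (@block_adj_sym P) (@block_adj_irr P).

Definition contracted P : {set flat_graph P} :=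
  [set B : flat_graph P | 1 < #|val B|].

Definition connected_in B : bool :=
  [forall u in B, forall v in B,
    connect [rel a b | [&& a \in B, b \in B & adj a b]] u v].

Lemma partitionTP P :
  reflect [/\ set0 \notin P, forall v, exists2 B, B \in P & v \in B
            & forall B C v, B \in P -> C \in P -> v \in B -> v \in C -> B = C]
          (partition P [set: G]).
Proof.
apply: (iffP and3P) => [[/eqP cP tP n0] | [n0 cP tP]]; split=> //.
- by move=> v; apply/bigcupP; rewrite -/(cover P) cP.
- by move=> B C v BP CP vB vC; rewrite -(def_pblock tP BP vB) (def_pblock tP CP vC).
- by apply/eqP/setP => v; rewrite inE; apply/bigcupP.
- apply/trivIsetP => B C BP CP; apply: contraR.
  by case/pred0Pn => v /andP [/= vB vC]; apply/eqP/(tP _ _ v).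
Qed.

Let in_merge P B C D :
  (D \in (B :|: C) |: (P :\: [set B; C])) =
  (D == B :|: C) || [&& D != B, D != C & D \in P].
Proof. by rewrite !inE negb_or -andbA. Qed.

Let block_adjP B C :
  reflect (B != C /\ exists v w, [/\ v \in B, w \in C & adj v w]) (block_adj B C).
Proof.
apply: (iffP andP) => -[BC h]; split=> //.
  by case/exists_inP: h => v vB /exists_inP [w wC vw]; exists v, w.
case: h => v [w [vB wC vw]].
by apply/exists_inP; exists v => //; apply/exists_inP; exists w.
Qed.

Let connected_inP B :
  reflect {in B &, forall u v,
            connect [rel a b | [&& a \in B, b \in B & adj a b]] u v}
          (connected_in B).
Proof.
apply: (iffP forall_inP) => [h u v uB vB | h u uB].
  by move/forall_inP: (h u uB); apply.
by apply/forall_inP => v vB; apply: h.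
Qed.

Let connected_in_merge B C :
  block_adj B C -> connected_in B -> connected_in C -> connected_in (B :|: C).
Proof.
move=> /block_adjP [_ [b [c [bB cC bc]]]] /connected_inP hB /connected_inP hC.
set e := [rel u v | [&& u \in B :|: C, v \in B :|: C & adj u v]].
have esym : connect_sym e.
  by apply: sym_connect_sym => u v; rewrite /e /= adj_sym andbCA.
have sub (D : {set G}) u v : D \subset B :|: C ->
    connect [rel a b | [&& a \in D, b \in D & adj a b]] u v -> connect e u v.
  move=> /subsetP DBC; apply: connect_sub => a a' /and3P [aD a'D aa'].
  by apply: connect1; rewrite /e /= !DBC.
have to_b u : u \in B :|: C -> connect e u b.
  rewrite inE => /orP [uB | uC]; first by apply: sub (subsetUl _ _) _; apply: hB.
  apply: (connect_trans (y := c)).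
    by apply: sub (subsetUr _ _) _; apply: hC.
  by rewrite esym; apply: connect1; rewrite /e /= !inE bB cC orbT.
apply/connected_inP => u v uD vD.
by apply: (connect_trans (to_b u uD)); rewrite esym to_b.
Qed.

Let partition_merge P B C : B \in P -> C \in P ->
  partition P [set: G] ->
  partition ((B :|: C) |: (P :\: [set B; C])) [set: G].
Proof.
move=> BP CP /partitionTP [n0 cP tP]; apply/partitionTP; split.
- rewrite in_merge negb_or !negb_and (negbTE n0) /= !orbT andbT eq_sym.
  by apply: contra n0; rewrite setU_eq0 => /andP [/eqP <- _].
- move=> v; have [D DP vD] := cP v.
  have [DBC | /negbTE nD] := boolP ((D == B) || (D == C)).
    exists (B :|: C); first by rewrite in_merge eqxx.
    by case/orP: DBC => /eqP <-; rewrite inE vD ?orbT.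
  by exists D => //; rewrite in_merge DP andbT -negb_or nD orbT.
- have key D v : v \in B :|: C -> [&& D != B, D != C & D \in P] -> v \in D -> False.
    rewrite inE => vBC /and3P [/eqP DB /eqP DC DP] vD.
    by case/orP: vBC => vX; [apply: DB | apply: DC]; apply: (tP _ _ v).
  move=> D E v; rewrite !in_merge.
  case/predU1P => [-> | hD]; case/predU1P => [-> | hE] // vD vE.
  + by case: (key E v).
  + by case: (key D v).
  + by case/and3P: hD hE => _ _ DP /and3P [_ _ EP]; apply: (tP _ _ v).
Qed.

Let edge_contractionP P Q :
  reflect (exists B C, [/\ B \in P, C \in P, block_adj B C
             & Q = (B :|: C) |: (P :\: [set B; C])]) (edge_contraction P Q).
Proof.
apply: (iffP exists_inP) => [[B BP /exists_inP [C CP /andP [BC /eqP ->]]] | ].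
  by exists B, C.
move=> [B [C [BP CP BC ->]]]; exists B => //.
by apply/exists_inP; exists C => //; rewrite BC eqxx.
Qed.

Let connected_partition P :=
  partition P [set: G] && [forall B in P, connected_in B].

Let connected_partition_singletons : connected_partition singletons.
Proof.
apply/andP; split; last first.
  apply/forall_inP => _ /imsetP [v _ ->]; apply/connected_inP => u w.
  by rewrite !inE => /eqP -> /eqP ->; apply: connect0.
apply/partitionTP; split.
- by apply/imsetP => -[v _ /setP/(_ v)]; rewrite !inE eqxx.
- by move=> v; exists [set v]; rewrite ?inE // imset_f.
- by move=> _ _ v /imsetP [b _ ->] /imsetP [c _ ->] /set1P <- /set1P <-.
Qed.

Let connected_partition_contraction P Q :
  edge_contraction P Q -> connected_partition P -> connected_partition Q.
Proof.
case/edge_contractionP => B [C [BP CP BC ->]] /andP [pP /forall_inP cP].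
rewrite /connected_partition partition_merge //=.
apply/forall_inP => D; rewrite in_merge => /predU1P [-> | /and3P [_ _ DP]].
  by apply: connected_in_merge; rewrite ?cP.
exact: cP.
Qed.

(* Flats correspond to the partitions of the vertex set into connected blocks. *)
Lemma flatE P :
  flat P = partition P [set: G] && [forall B in P, connected_in B].
Proof.
rewrite -/(connected_partition P); apply/idP/idP.
  case/connectP => s + ->; move: connected_partition_singletons.
  elim: s singletons => [//|Q' s IH] Q /= Qc /andP [QQ' Q's].
  exact: IH (connected_partition_contraction QQ' Qc) Q's.
move=> /andP [/partitionTP [P0 Pc Pt] /forall_inP Pconn].
suff main n : forall Q, #|Q| <= n -> flat Q -> connected_partition Q ->
    (forall C, C \in Q -> exists2 B, B \in P & C \subset B) -> flat P.
  apply: (main _ singletons (leqnn _)); [exact: connect0 | done |].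
  move=> _ /imsetP [v _ ->]; have [B BP vB] := Pc v.
  by exists B; rewrite // sub1set.
elim: n => [|n IH] Q Qn fQ Qcp Qref; have /andP [/partitionTP [Q0 Qc Qt] _] := Qcp.
  have Pe : P = set0.
    apply/setP => B; rewrite inE; apply/negbTE/negP => BP.
    have [B0 | [v vB]] := set_0Vmem B; first by rewrite B0 (negbTE P0) in BP.
    have [C CQ _] := Qc v.
    by move: Qn; rewrite leqn0 cards_eq0 => /eqP Q00; rewrite Q00 inE in CQ.
  suff -> : P = Q by [].
  by rewrite Pe; apply/esym/eqP; rewrite -cards_eq0 -leqn0.
have [QP | /subsetPn [C CQ CnP]] := boolP (Q \subset P).
  suff -> : P = Q by [].
  apply/eqP; rewrite eqEsubset QP andbT; apply/subsetP => B BP.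
  have [B0 | [v vB]] := set_0Vmem B; first by rewrite B0 (negbTE P0) in BP.
  have [C CQ vC] := Qc v.
  by rewrite (Pt B C v) // (subsetP QP).
have [B BP CB] := Qref C CQ.
have [C0 | [u uC]] := set_0Vmem C; first by rewrite C0 (negbTE Q0) in CQ.
have /subsetPn [w wB wC] : ~~ (B \subset C).
  by apply: contra CnP => BC; have /eqP -> : C == B by rewrite eqEsubset CB.
have /connected_inP/(_ u w (subsetP CB _ uC) wB) := Pconn B BP.
set e := [rel a b | _] => uw.
have [a [b [aC bC /and3P [_ bB ab]]]] : exists a b, [/\ a \in C, b \notin C & e a b].
  case/connectP: uw => s us wE; rewrite {}wE in wC; clear wB.
  elim: s u uC us wC => [|v s IHs] u uC /=; first by rewrite uC.
  case/andP => uv vs lC; have [vC | vC] := boolP (v \in C).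
    exact: IHs lC.
  by exists u, v.
have [C' C'Q bC'] := Qc b.
have CC' : C != C' by apply: contra bC => /eqP ->.
have C'B : C' \subset B.
  by have [B' B'P C'B'] := Qref _ C'Q; rewrite (Pt B B' b) // (subsetP C'B').
have QQ' : edge_contraction Q ((C :|: C') |: (Q :\: [set C; C'])).
  apply/edge_contractionP; exists C, C'; split=> //.
  by apply/block_adjP; split=> //; exists a, b.
apply: (IH _ _ (connect_trans fQ (connect1 QQ')) (connected_partition_contraction QQ' Qcp)).
  apply: leq_trans (leq_card_setU _ _) _; rewrite cards1 add1n.
  have sCC' : [set C; C'] \subset Q by rewrite subUset !sub1set CQ.
  rewrite cardsD (setIidPr sCC') cards2 CC' /=.
  have := subset_leq_card sCC'; rewrite cards2 CC' /= => h.
  by rewrite -(leq_add2r 1) !addn1 in Qn *; rewrite -subSn // subSS subn1 -ltnS prednK // (leq_trans _ h).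
move=> D; rewrite in_merge => /predU1P [-> | /and3P [_ _ DQ]]; last exact: Qref.
by exists B; rewrite // subUset CB.
Qed.

End Flats.

Section AcyclicColorings.
Variable H : sgraph.

Definition orientation (o : {set H * H}) : bool :=
  [forall v : H, forall w : H,
    if adj v w then ((v, w) \in o) (+) ((w, v) \in o) else (v, w) \notin o].

Definition acyclic (o : {set H * H}) : bool :=
  [forall v : H, forall w : H,
    ((v, w) \in o) ==> ~~ connect (fun a b => (a, b) \in o) w v].

Lemma acyclicP (o : {set H * H}) :
  reflect (forall s : seq H, s != [::] -> ~~ cycle (fun a b => (a, b) \in o) s)
          (acyclic o).
Proof.
apply: (iffP forallP) => [h [//|v s] _ | h v].
  apply/negP; rewrite /= rcons_path => /andP [vs sv].
  have /forallP/(_ v)/implyP/(_ sv)/negP := h (last v s); apply.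
  by apply/connectP; exists s.
apply/forallP => w; apply/implyP => vw; apply/negP => /connectP [s ws vE].
have /negP := h (w :: s) isT; apply.
by rewrite /= rcons_path ws -vE.
Qed.

Definition compatible (x : nat) (o : {set H * H}) (c : {ffun H -> 'I_x}) : bool :=
  [forall v : H, forall w : H, ((v, w) \in o) ==> (color (c v) <= color (c w))].

End AcyclicColorings.

Definition num_acyclic_colorings (G : sgraph) (P : {set {set G}}) (x y : nat) : nat :=
  #|[set oc : {set flat_graph P * flat_graph P} * {ffun flat_graph P -> 'I_x} |
      [&& orientation oc.1, acyclic oc.1, compatible oc.1 oc.2 &
          [forall v in contracted P, y < color (oc.2 v)]]]|.

(* Main.v *)
Require Import Defs.
From mathcomp Require Import all_boot all_order all_algebra.
From mathcomp Require Import polyXY.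
Set Implicit Arguments. Unset Strict Implicit. Unset Printing Implicit Defensive.
Import GRing.Theory.

(** A pair (flat, acyclic orientation of it) is encoded on the vertices of [G]
    itself, as a set [X] of arrows carrying at least one direction of every
    edge: an edge is contracted when both directions are present, and
    acyclicity of the quotient says that every arrow of [X] lying on a cycle is
    reversed in [X].  Weight such an [X] by (-1) to the number of components of
    its two-way edges (the vertices of the flat), and by 0 if it is not acyclic.
    For a new edge [uv], the weights of [X + uv], [X + vu] and [X + uv + vu] add
    up to the weight of [X].  Hence, for a fixed colouring [c], the signed sum
    of the weights of the sets compatible with [c] obeys, edge by edge, the
    inclusion-exclusion recursion over the violated edges (monochromatic, of
    colour at most [y]) that computes the bivariate chromatic polynomial.  When
    no edge is left to process, all edges of a set [A] are required to be
    violated: the polynomial is the monomial x^a y^b with [a + b] the number of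
    components of [A], so negating [x] and [y] multiplies it by the weight of
    [A]. *)

(** * Weights of weak orientations *)

Section WeakOrientations.
Variable V : finType.
Implicit Types (D A X : {set V * V}) (u v p q : V) (S : seq (V * V)).

Definition arrow D : rel V := fun u v => (u, v) \in D.

Definition core D : rel V := [rel u v | arrow D u v && arrow D v u].

Definition cycles_reversible D : bool :=
  [forall u, forall v, arrow D u v && connect (arrow D) v u ==> arrow D v u].

Definition weight D : int :=
  if cycles_reversible D then ((-1) ^+ n_comp (core D) V)%R else 0%R.

Arguments arrow : simpl never.

Lemma cycles_reversibleP D :
  reflect (forall u v, arrow D u v -> connect (arrow D) v u -> arrow D v u)
          (cycles_reversible D).
Proof.
apply: (iffP forallP) => [h u v uv vu | h u].
  by have /forallP/(_ v)/implyP := h u; apply; rewrite uv.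
by apply/forallP => v; apply/implyP => /andP [uv vu]; apply: h uv vu.
Qed.

Lemma core_sym D : connect_sym (core D).
Proof. by apply: sym_connect_sym => u v; rewrite /core /= andbC. Qed.

Lemma arrowU D u v p q : arrow ((u, v) |: D) p q = (p == u) && (q == v) || arrow D p q.
Proof. by rewrite /arrow in_setU1 xpair_eqE. Qed.

Lemma connect_arrowU D u v p q :
  connect (arrow ((u, v) |: D)) p q =
  connect (arrow D) p q || connect (arrow D) p u && connect (arrow D) v q.
Proof.
apply/idP/idP => [/connectP [s + ->] {q} | ].
  elim: s p => [|w s IH] p /=; first by rewrite connect0.
  rewrite arrowU => /andP [+ /IH {IH}]; case/orP => [/andP [/eqP -> /eqP ->] | pw].
    by case/orP => [vs | /andP [_ vs]]; rewrite connect0 vs !orbT.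
  case/orP => [ws | /andP [wu ->]].
    by rewrite (connect_trans (connect1 pw) ws).
  by rewrite (connect_trans (connect1 pw) wu) orbT.
have sub a b : connect (arrow D) a b -> connect (arrow ((u, v) |: D)) a b.
  by apply: connect_sub => {}a {}b ab; apply: connect1; rewrite arrowU ab orbT.
case/orP => [/sub // | /andP [/sub pu /sub vq]].
apply: connect_trans pu (connect_trans (connect1 _) vq).
by rewrite arrowU !eqxx.
Qed.

Lemma cycles_reversible_sub D D' :
  D \subset D' -> (forall u v, arrow D u v -> arrow D' v u -> arrow D v u) ->
  cycles_reversible D' -> cycles_reversible D.
Proof.
move=> /subsetP sDD' back /cycles_reversibleP h; apply/cycles_reversibleP => u v uv vu.
apply: back => //; apply: h; first exact: sDD'.
by apply: connect_sub vu => a b ab; apply/connect1/sDD'.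
Qed.

(** A return path in [D'] puts every arrow of the path from [u] to [v] on a cycle of [D'], so each
    one is reversed there. Used both with [D' = D] and with [D'] obtained by adding a two-way
    edge. *)
Lemma connect_reversible D D' u v :
  D \subset D' -> cycles_reversible D' ->
  connect (arrow D) u v -> connect (arrow D') v u ->
  connect [rel a b | arrow D a b && arrow D' b a] u v.
Proof.
move=> /subsetP sDD' /cycles_reversibleP h /connectP [s + ->] {v}.
elim: s u => [|w s IH] u //= /andP [uw ws] lu.
have uw' : arrow D' u w by apply: sDD'.
apply: (connect_trans (y := w)); last by apply: IH ws (connect_trans lu (connect1 uw')).
apply: connect1; rewrite /= uw; apply: h => //; apply: connect_trans lu.
apply/connectP; exists s => //.
by apply: sub_path ws => a b; apply: sDD'.
Qed.

(** The closure of [u] and [v] is one component for [e'], and one or two for [e] according to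
    whether [e] connects [u] and [v]. Outside this closure the two relations agree. *)
Lemma n_comp_add_edge (e e' : rel V) u v :
  connect_sym e -> connect_sym e' ->
  (forall p q, e' p q = [|| e p q, (p == u) && (q == v) | (p == v) && (q == u)]) ->
  n_comp e V = n_comp e' V + ~~ connect e u v.
Proof.
move=> esym esym' e'E.
have sub p q : connect e p q -> connect e' p q.
  by apply: connect_sub => {}p {}q pq; apply: connect1; rewrite e'E pq.
pose a := closure e (pred2 u v).
have ua : u \in a by apply: mem_closure; rewrite !inE eqxx.
have va : v \in a by apply: mem_closure; rewrite !inE eqxx orbT.
have cl : closed e a by apply: closure_closed.
have cl' : closed e' a.
  move=> p q; rewrite e'E => /or3P [/cl // | |] /andP [/eqP -> /eqP ->].
    by rewrite ua va.
  by rewrite ua va.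
have uv' : connect e' u v by apply: connect1; rewrite e'E !eqxx orbT.
have aE : a =i closure e' (pred2 u v).
  move=> w; apply/idP/idP.
    rewrite unfold_in => /pred0Pn [z /andP [/= wz zuv]].
    by rewrite unfold_in; apply/pred0Pn; exists z; rewrite /= zuv andbT; apply: sub.
  rewrite unfold_in => /pred0Pn [z /andP [/= wz zuv]].
  by rewrite (closed_connect cl' wz); case/pred2P: zuv => ->.
have := n_comp_closure2 esym u v; rewrite -/a => h1.
have := n_comp_closure2 esym' u v; rewrite -(eq_n_comp_r aE) uv' => h2.
rewrite (n_compC a e) (n_compC a e') h1 h2.
have -> : n_comp e [predC a] = n_comp e' [predC a].
  have cl'C : closed e' [predC a] by move=> p q /cl'; rewrite !inE => ->.
  have adj : rel_adjunction id e' e [predC a].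
    apply: strict_adjunction => //.
      by apply/subsetP => p _; apply/codomP; exists p.
    move=> p q; rewrite /= !inE negbK => pa; rewrite e'E.
    case: (p =P u) pa => [->|_]; rewrite ?ua //.
    by case: (p =P v) => [->|_]; rewrite ?va // !orbF.
  by rewrite (adjunction_n_comp id esym' esym cl'C adj).
by case: (connect e u v) => /=; rewrite ?addn0 ?addn1.
Qed.

(** Without a path from [v] back to [u], the new arrow lies on no cycle, so neither the
    reversibility condition nor the two-way edges change. *)
Lemma weight_arrow D u v :
  (u, v) \notin D -> (v, u) \notin D -> ~~ connect (arrow D) v u ->
  weight ((u, v) |: D) = weight D.
Proof.
move=> uvD vuD nvu; have uv : u != v by apply: contraNneq nvu => ->; exact: connect0.
have nvu' : ~~ connect (arrow ((u, v) |: D)) v u.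
  by rewrite connect_arrowU negb_or nvu (negbTE nvu).
have newE p q : arrow D p q ->
    ((p == u) && (q == v) = false) * ((p == v) && (q == u) = false).
  by move=> pq; split; apply: contraTF pq => /andP [/eqP -> /eqP ->]; rewrite /arrow ?uvD ?vuD.
have revE p q : arrow D p q -> arrow ((u, v) |: D) q p = arrow D q p.
  by move=> pq; rewrite arrowU [X in X || _]andbC !(newE _ _ pq).
have coreE : core ((u, v) |: D) =2 core D.
  move=> p q; rewrite /core /=; case pq: (arrow D p q).
    by rewrite (revE _ _ pq) arrowU pq orbT.
  case qp: (arrow D q p); first by rewrite (revE _ _ qp) pq.
  rewrite !arrowU pq qp !orbF; apply/negP.
  by case/andP=> /andP [/eqP -> _] /andP [_ uvE]; rewrite uvE in uv.
rewrite /weight (eq_n_comp (eq_connect coreE)).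
have -> // : cycles_reversible ((u, v) |: D) = cycles_reversible D.
apply/idP/idP; first by apply: cycles_reversible_sub => [|p q /revE ->]; rewrite ?subsetUr.
move=> /cycles_reversibleP h; apply/cycles_reversibleP => p q.
rewrite arrowU => /orP [/andP [/eqP -> /eqP ->] | pq]; first by rewrite (negbTE nvu').
rewrite (revE _ _ pq) connect_arrowU => /orP [/(h _ _ pq) // | /andP [qu vp]].
by case/negP: nvu; apply: connect_trans vp (connect_trans (connect1 pq) qu).
Qed.

Lemma weight_arrow_cycle D u v :
  u != v -> (u, v) \notin D -> connect (arrow D) u v -> weight ((v, u) |: D) = 0%R.
Proof.
move=> uv uvD cuv; rewrite /weight; case: ifP => // /cycles_reversibleP/(_ v u).
rewrite !arrowU !eqxx (negbTE uv) /= /arrow (negbTE uvD) connect_arrowU cuv.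
by move=> /(_ isT isT).
Qed.

(** If [D] has paths both ways and is reversible, [u] and [v] already share a component, so nothing
    changes. If it has a path one way only, the two-way edge puts that path on cycles without
    reversing it. If it has none, two components merge and the sign flips. *)
Lemma weight_edge D u v :
  u != v -> (u, v) \notin D -> (v, u) \notin D ->
  weight ((u, v) |: ((v, u) |: D)) =
  (if connect (arrow D) u v then if connect (arrow D) v u then weight D else 0
   else if connect (arrow D) v u then 0 else - weight D)%R.
Proof.
move=> uv uvD vuD; set D' := _ |: _.
have arrowE p q : arrow D' p q =
    [|| arrow D p q, (p == u) && (q == v) | (p == v) && (q == u)].
  by rewrite /D' !arrowU orbA orbC.
have subD : D \subset D' by apply: subset_trans (subsetUr _ _) (subsetUr _ _).
have newE p q : arrow D p q ->
    ((p == u) && (q == v) = false) * ((p == v) && (q == u) = false).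
  by move=> pq; split; apply: contraTF pq => /andP [/eqP -> /eqP ->]; rewrite /arrow ?uvD ?vuD.
have revE p q : arrow D p q -> arrow D' q p = arrow D q p.
  by move=> pq; rewrite arrowE ![(q == _) && _]andbC !(newE _ _ pq) !orbF.
have sub : cycles_reversible D' -> cycles_reversible D.
  by apply: cycles_reversible_sub => // p q /revE ->.
have coreE p q : core D' p q =
    [|| core D p q, (p == u) && (q == v) | (p == v) && (q == u)].
  rewrite /core /=; case pq: (arrow D p q).
    by rewrite (revE _ _ pq) !(newE _ _ pq) !orbF arrowE pq.
  case qp: (arrow D q p).
    by rewrite (revE _ _ qp) pq /= ![(p == _) && _]andbC !(newE _ _ qp).
  rewrite !arrowE pq qp /= ![(q == _) && _]andbC [X in _ && X]orbC.
  by rewrite andbb.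
have compE := n_comp_add_edge (core_sym D) (core_sym D') coreE.
have cuv' : connect (arrow D') u v by apply: connect1; rewrite arrowE !eqxx orbT.
have cvu' : connect (arrow D') v u by apply: connect1; rewrite arrowE !eqxx !orbT.
(* Passing to [D'] reverses no arrow of [D] that was not already reversed, so such a path runs along
   two-way edges of [D]. *)
have back a b : connect [rel a b | arrow D a b && arrow D' b a] a b -> connect (arrow D) b a.
  move=> ab; have : connect (core D) b a.
    rewrite (core_sym D); apply: connect_sub ab => {}a {}b /= /andP [ab].
    by rewrite (revE _ _ ab) => ba; apply: connect1; rewrite /core /= ab.
  by apply: connect_sub => {ab}a {}b /andP [ab _]; apply: connect1.
have [cuv | ncuv] := boolP (connect (arrow D) u v);
  have [cvu | ncvu] := boolP (connect (arrow D) v u).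
- rewrite /weight; case crD: (cycles_reversible D); last first.
    by case: ifP => // /sub; rewrite crD.
  have -> : cycles_reversible D'.
    apply/cycles_reversibleP => p q; rewrite arrowE => /orP [pq | new _].
      rewrite (revE _ _ pq) !connect_arrowU => qp.
      move/cycles_reversibleP: crD => /(_ p q pq); apply.
      case/orP: qp => [/orP [// | /andP [qv up]] | /andP []].
        exact: connect_trans qv (connect_trans cvu up).
      case/orP=> [qu | /andP [qv _]] /orP [vp | /andP [_ up]].
      + exact: connect_trans qu (connect_trans cuv vp).
      + exact: connect_trans qu up.
      + exact: connect_trans qv vp.
      + exact: connect_trans qv (connect_trans cvu up).
    by rewrite arrowE ![(q == _) && _]andbC [X in _ || X]orbC new orbT.
  rewrite compE.
  by rewrite (connect_reversible (subxx D) crD cuv cvu) addn0.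
- rewrite /weight; case: ifP => // crD'; case/negP: ncvu.
  exact/back/(connect_reversible subD crD').
- rewrite /weight; case: ifP => // crD'; case/negP: ncuv.
  exact/back/(connect_reversible subD crD').
rewrite /weight.
(* A path from [q] to [p] that crosses the new edge in one direction only would, with the arrow
   [pq], connect [u] and [v] in [D]. If it crosses both ways, the detour can be cut out. *)
have -> : cycles_reversible D' = cycles_reversible D.
  apply/idP/idP => // /cycles_reversibleP h; apply/cycles_reversibleP => p q.
  rewrite arrowE => /orP [pq | new _]; last first.
    by rewrite arrowE ![(q == _) && _]andbC [X in _ || X]orbC new orbT.
  rewrite (revE _ _ pq) !connect_arrowU => qp; apply: h => //.
  case/orP: qp => [/orP [// | /andP [qv up]] | /andP []].
    case/negP: ncuv; exact: connect_trans up (connect_trans (connect1 pq) qv).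
  case/orP=> [qu | /andP [qv _]] /orP [vp | /andP [_ up]].
  + case/negP: ncvu; exact: connect_trans vp (connect_trans (connect1 pq) qu).
  + exact: connect_trans qu up.
  + exact: connect_trans qv vp.
  + case/negP: ncuv; exact: connect_trans up (connect_trans (connect1 pq) qv).
case: ifP => [_|_]; last by rewrite oppr0.
rewrite compE.
have -> : ~~ connect (core D) u v.
  apply: contra ncuv; apply: connect_sub => a b /andP [ab _]; exact: connect1.
by rewrite addn1 exprS mulN1r opprK.
Qed.

(** Write W for [weight D]. The three terms are 0, 0, W if [D] has paths both ways between [u] and
    [v]; W, 0, 0 if only from [u] to [v]; 0, W, 0 if only from [v] to [u]; and W, W, -W if there is
    none. *)
Lemma weight_orient_edge D u v :
  u != v -> (u, v) \notin D -> (v, u) \notin D ->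
  (weight ((u, v) |: D) + weight ((v, u) |: D) +
    weight ((u, v) |: ((v, u) |: D)) = weight D)%R.
Proof.
move=> uv uvD vuD; have vu : v != u by rewrite eq_sym.
rewrite weight_edge //; case: ifPn => cuv; case: ifPn => cvu.
- by rewrite !weight_arrow_cycle // !add0r.
- by rewrite weight_arrow // weight_arrow_cycle // !addr0.
- by rewrite (@weight_arrow _ v u) // weight_arrow_cycle // add0r addr0.
by rewrite !weight_arrow // addrK.
Qed.

(** * Sums over weak orientations compatible with a colouring *)

Definition joins S : rel V := fun p q => ((p, q) \in S) || ((q, p) \in S).

Definition orients S X : bool :=
  [forall p, forall q, arrow X p q ==> joins S p q] &&
  all (fun e => (e \in X) || ((e.2, e.1) \in X)) S.

(* Each edge occurs once in [S], in one direction, and is not yet in [D]. *)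
Fixpoint fresh D S : bool :=
  if S is (u, v) :: S' then
    [&& u != v, (u, v) \notin D, (v, u) \notin D
      & fresh ((u, v) |: ((v, u) |: D)) S']
  else true.

(* Raw values of ['I_x] are one less than [color]: [y <= c p] is [y < color (c p)]. *)
Definition admissible x (y : nat) (c : {ffun V -> 'I_x}) X : bool :=
  [forall p, forall q,
     arrow X p q ==> (c p <= c q) && (arrow X q p ==> (y <= c p))].

(** [D] holds the arrows already fixed: they enter the weight, while the colouring constrains only
    the arrows [X] chosen on [S]. *)
Definition orientation_sum x (y : nat) (c : {ffun V -> 'I_x}) D S : int :=
  (\sum_(X | admissible y c X && orients S X) weight (X :|: D))%R.

Lemma joins_sym S p q : joins S p q = joins S q p.
Proof. by rewrite /joins orbC. Qed.

Lemma joins_cons u v S p q :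
  joins ((u, v) :: S) p q =
  [|| (p == u) && (q == v), (p == v) && (q == u) | joins S p q].
Proof.
by rewrite /joins !inE !xpair_eqE [(q == u) && _]andbC orbACA !orbA.
Qed.

Lemma fresh_joins D S p q : fresh D S -> joins S p q -> ~~ arrow D p q.
Proof.
elim: S D => [//|[u v] S IH] D /= /and4P [uv uvD vuD frS].
rewrite joins_cons => /or3P [/andP [/eqP -> /eqP ->] | /andP [/eqP -> /eqP ->] | ] //.
by move/(IH _ frS); rewrite !arrowU !negb_or => /and3P [].
Qed.

Lemma fresh_sub D D' S : D' \subset D -> fresh D S -> fresh D' S.
Proof.
elim: S D D' => [//|[u v] S IH] D D' /= DD' /and4P [-> uvD vuD frS].
rewrite !(contra (subsetP DD' _)) //=.
by apply: IH frS; rewrite !setUS.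
Qed.

Lemma fresh_behead D u v S : fresh D ((u, v) :: S) -> fresh D S.
Proof.
case/and4P => _ _ _; apply: fresh_sub.
by apply: subset_trans (subsetUr _ _) (subsetUr _ _).
Qed.

Lemma fresh_swap D u v p q S :
  fresh D ((u, v) :: (p, q) :: S) -> fresh D ((p, q) :: (u, v) :: S).
Proof.
rewrite /= !in_setU1 !negb_or => /and4P [-> -> ->].
case/and4P => -> /and3P [n1 n2 ->] /and3P [n3 n4 ->] frS /=.
rewrite ![(u, v) == _]eq_sym ![(v, u) == _]eq_sym n1 n2 n3 n4 /=.
move: frS; apply: fresh_sub; apply/subsetP => e; rewrite !in_setU1.
by case/or4P => [->|->|->|/orP[]->]; rewrite ?orbT.
Qed.

Lemma orientsP S X :
  reflect ((forall p q, arrow X p q -> joins S p q) /\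
           (forall p q, joins S p q -> arrow X p q || arrow X q p))
          (orients S X).
Proof.
apply: (iffP andP) => -[h1 h2]; split.
- by move=> p q pq; have /forallP/(_ p)/forallP/(_ q)/implyP := h1; apply.
- by move=> p q /orP [] /(allP h2) //=; rewrite orbC.
- by apply/forallP => p; apply/forallP => q; apply/implyP; apply: h1.
- by apply/allP => -[p q] pqS; apply: h2; rewrite /joins pqS.
Qed.

Lemma admissibleP x y (c : {ffun V -> 'I_x}) X :
  reflect (forall p q, arrow X p q -> c p <= c q /\ (arrow X q p -> y <= c p))
          (admissible y c X).
Proof.
apply: (iffP forallP) => [h p q pq | h p].
  by have /forallP/(_ q)/implyP/(_ pq)/andP [-> /implyP] := h p.
apply/forallP => q; apply/implyP => /h [-> hy] /=; exact/implyP.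
Qed.

Lemma fresh_orients D u v S X :
  fresh D ((u, v) :: S) -> orients [:: (u, v)] X -> fresh (X :|: D) S.
Proof.
case/and4P => _ _ _ frS /orientsP [oX _]; apply: fresh_sub frS.
apply/subsetP => -[p q]; rewrite !in_setU1 in_setU => /orP [/oX | ->].
  by rewrite joins_cons orbF !xpair_eqE orbA => ->.
by rewrite !orbT.
Qed.

Section Coloring.
Variables (x y : nat) (c : {ffun V -> 'I_x}).

Lemma orientation_sum_nil D : orientation_sum y c D [::] = weight D.
Proof.
rewrite /orientation_sum (big_pred1 set0) ?set0U // => X /=.
apply/andP/eqP => [[_ /orientsP [h _]] | ->].
  by apply/setP => -[p q]; rewrite inE; apply/negP => /h.
by split; [apply/admissibleP | apply/orientsP; split] => p q; rewrite /arrow ?inE.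
Qed.

(** Admissibility and orientation are conditions on each edge separately, and freshness keeps [uv]
    out of [S], so the choices on [uv] and on [S] are independent. *)
Lemma orientation_sum_split D u v S :
  fresh D ((u, v) :: S) ->
  orientation_sum y c D ((u, v) :: S) =
  (\sum_(Y | admissible y c Y && orients [:: (u, v)] Y)
     orientation_sum y c (Y :|: D) S)%R.
Proof.
move=> /= /and4P [uv uvD vuD frS].
have [E EE] : exists E, forall p q, arrow E p q = joins [:: (u, v)] p q.
  by exists [set (u, v); (v, u)] => p q; rewrite /arrow !inE !xpair_eqE joins_cons orbF.
have jS p q : joins S p q -> ~~ arrow E p q.
  move=> /(fresh_joins frS); rewrite !arrowU EE joins_cons orbA negb_or orbF.
  by case/andP.
have consE p q : joins ((u, v) :: S) p q = arrow E p q || joins S p q.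
  by rewrite EE !joins_cons orbF orbA.
have Esym p q : arrow E p q = arrow E q p by rewrite !EE joins_sym.
(* Group the sets by their trace [Y] on the two directions of [uv]; below, adding [Y] and removing
   [E] are mutually inverse. *)
rewrite /orientation_sum (partition_big (fun X => X :&: E)
  (fun Y => admissible y c Y && orients [:: (u, v)] Y)) /=; last first.
  move=> X /andP [/admissibleP aX /orientsP [oX oX']]; apply/andP; split.
    apply/admissibleP => p q; rewrite /arrow !inE => /andP [/aX [-> h] _].
    by split=> // /andP [/h].
  apply/orientsP; split=> p q; rewrite -EE /arrow !in_setI; first by case/andP.
  move=> pqE.
  have qpE : (q, p) \in E by rewrite -/(arrow E q p) -Esym.
  by rewrite pqE qpE !andbT; apply: oX'; rewrite consE /arrow pqE.
apply: eq_bigr => Y /andP [/admissibleP aY /orientsP [oY oY']].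
rewrite (reindex_onto (fun X => X :|: Y) (fun X => X :\: E)) /=; last first.
  move=> X /andP [_ /eqP <-]; by rewrite setUC setID.
have YE p q : arrow Y p q -> arrow E p q by move/oY; rewrite EE.
apply: eq_big => [X | X _]; last by rewrite setUA.
have arrowXY p q : arrow (X :|: Y) p q = arrow X p q || arrow Y p q by rewrite /arrow inE.
apply/idP/idP => [/andP [/andP [/andP [/admissibleP aXY /orientsP [oXY oXY']] _] /eqP XE]
                 | /andP [/admissibleP aX /orientsP [oX oX']]].
  have XnE p q : arrow X p q -> ~~ arrow E p q by rewrite /arrow -XE in_setD => /andP [].
  apply/andP; split.
    apply/admissibleP => p q pq; have [|-> h] := aXY p q; rewrite ?arrowXY ?pq //.
    by split=> // qp; apply: h; rewrite arrowXY qp.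
  apply/orientsP; split=> p q pq.
    have := oXY p q; rewrite arrowXY pq consE => /(_ isT).
    by rewrite (negbTE (XnE _ _ pq)).
  have := oXY' p q; rewrite consE pq orbT !arrowXY => /(_ isT).
  have nY : arrow Y p q || arrow Y q p = false.
    apply/negP => /orP [] /YE; last rewrite -Esym; by rewrite (negbTE (jS _ _ pq)).
  by rewrite orbACA nY orbF.
have XnE p q : arrow X p q -> ~~ arrow E p q by move/oX/jS.
have YnX p q : arrow Y p q -> arrow X q p = false.
  by move=> /YE; rewrite Esym => pqE; apply: contraTF pqE => /XnE.
have XnY p q : arrow X p q -> arrow Y q p = false.
  by move=> pq; apply: contraTF pq => /YnX ->.
have -> /= : admissible y c (X :|: Y).
  apply/admissibleP => p q; rewrite !arrowXY => /orP [pq | pq].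
    by rewrite XnY // orbF; apply: aX.
  by rewrite YnX //; apply: aY.
have -> /= : orients ((u, v) :: S) (X :|: Y).
  apply/orientsP; split=> p q.
    by rewrite arrowXY consE => /orP [/oX -> | /YE ->]; rewrite ?orbT.
  rewrite consE !arrowXY orbACA => /orP [| /oX' -> //].
  by rewrite EE => /oY' ->; rewrite orbT.
apply/andP; split.
- apply/eqP/setP => -[p q]; rewrite in_setI -!/(arrow _ p q) arrowXY.
  case pqY: (arrow Y p q); first by rewrite orbT YE.
  by rewrite orbF; apply/negP => /andP [/XnE/negP].
- apply/eqP/setP => -[p q]; rewrite in_setD -!/(arrow _ p q) arrowXY.
  case pqX: (arrow X p q); first by rewrite XnE.
  by apply/negP => /andP [/negP h /YE].
Qed.

Lemma big_orients1 u v (F : {set V * V} -> int) : u != v ->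
  (\sum_(Y | admissible y c Y && orients [:: (u, v)] Y) F Y =
   (if (c u <= c v)%N then F [set (u, v)] else 0) +
   (if (c v <= c u)%N then F [set (v, u)] else 0) +
   (if (c u == c v) && (y <= c u)%N then F [set (u, v); (v, u)] else 0))%R.
Proof.
move=> uv; have vu : v != u by rewrite eq_sym.
pose s := [:: [set (u, v)]; [set (v, u)]; [set (u, v); (v, u)]].
have arrow1 a b p q : arrow [set (a, b)] p q = (p == a) && (q == b).
  by rewrite /arrow inE xpair_eqE.
have arrow2 p q : arrow [set (u, v); (v, u)] p q = joins [:: (u, v)] p q.
  by rewrite joins_cons /arrow !inE !xpair_eqE orbF.
have us : uniq s.
  rewrite /= !inE negb_or !andbT -!andbA; apply/and3P; split; apply/eqP => /setP.
  - by move=> /(_ (u, v)); rewrite !inE !xpair_eqE !eqxx (negbTE uv).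
  - by move=> /(_ (v, u)); rewrite !inE !xpair_eqE !eqxx (negbTE uv) (negbTE vu).
  - by move=> /(_ (u, v)); rewrite !inE !xpair_eqE !eqxx (negbTE uv).
have inS Y : orients [:: (u, v)] Y = (Y \in s).
  apply/orientsP/idP => [[h1 h2] | ].
    have YE Z : arrow Y u v = arrow Z u v -> arrow Y v u = arrow Z v u ->
        (forall p q, arrow Z p q -> joins [:: (u, v)] p q) -> Y = Z.
      move=> uvE vuE hZ; apply/setP => -[p q]; rewrite -!/(arrow _ p q).
      have [pq | npq] := boolP (joins [:: (u, v)] p q); last first.
        by rewrite (contraNF (h1 p q)) // (contraNF (hZ p q)).
      by move: pq; rewrite joins_cons orbF => /orP [] /andP [/eqP -> /eqP ->].
    have := h2 u v; rewrite joins_cons !eqxx => /(_ isT).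
    rewrite !inE; case auv: (arrow Y u v); case avu: (arrow Y v u) => // _.
    - by rewrite [X in [|| _, _ | X]](introT eqP) ?orbT //; apply: YE => // [||p q];
        rewrite ?auv ?avu arrow2 // joins_cons !eqxx ?orbT.
    - rewrite [X in [|| X, _ | _]](introT eqP) //; apply: YE => // [||p q];
        rewrite ?auv ?avu arrow1 ?joins_cons ?eqxx ?(negbTE uv) ?(negbTE vu) //.
      by move=> ->.
    - rewrite [X in [|| _, X | _]](introT eqP) ?orbT //; apply: YE => // [||p q];
        rewrite ?auv ?avu arrow1 ?joins_cons ?eqxx ?(negbTE uv) ?(negbTE vu) //.
      by move=> ->; rewrite orbT.
  rewrite !inE => /or3P [] /eqP ->; split=> p q; rewrite ?arrow2 ?arrow1 joins_cons ?orbF //.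
  - by move=> ->.
  - by rewrite [X in _ -> _ || X]andbC.
  - by move=> ->; rewrite orbT.
  - by rewrite [X in _ -> _ || X]andbC orbC.
  - by rewrite joins_sym joins_cons orbF => ->.
rewrite (eq_bigl (fun Y => (Y \in s) && admissible y c Y)) => [|Y]; last by rewrite inS andbC.
rewrite big_mkcondr /= -big_uniq //= !big_cons big_nil addr0 addrA.
congr (_ + _ + _)%R; congr (if _ then _ else _).
- apply/admissibleP/idP => [/(_ u v)|le p q]; rewrite ?arrow1 ?eqxx.
    by case.
  by move=> /andP [/eqP -> /eqP ->]; rewrite (negbTE vu).
- apply/admissibleP/idP => [/(_ v u)|le p q]; rewrite ?arrow1 ?eqxx.
    by case.
  by move=> /andP [/eqP -> /eqP ->]; rewrite (negbTE uv).
apply/admissibleP/andP => [h | [/eqP ce cy] p q].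
  have [] := h u v; rewrite ?arrow2 ?joins_cons ?eqxx ?orbT // => cuv -> //.
  have [] := h v u; rewrite ?arrow2 ?joins_cons ?eqxx ?orbT // => cvu _.
  by rewrite -val_eqE /= eqn_leq cuv cvu.
rewrite arrow2 joins_cons orbF => /orP [] /andP [/eqP -> /eqP ->].
  by rewrite -ce; split.
by rewrite -ce; split.
Qed.

Definition weakly_increasing D := forall p q, arrow D p q -> c p <= c q.

Lemma weakly_increasing_connect D p q :
  weakly_increasing D -> connect (arrow D) p q -> c p <= c q.
Proof.
move=> mono /connectP [s + ->]; elim: s p => [//|w s IH] p /= /andP [/mono pw /IH].
exact: leq_trans.
Qed.

(** By induction on [S], the claim reduces to [uv] being the only edge left, where it follows from
    the weight identity for a single edge. *)
Lemma orientation_sum_cons D u v S :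
  weakly_increasing D -> fresh D ((u, v) :: S) ->
  (orientation_sum y c D ((u, v) :: S) =
   orientation_sum y c D S -
   if (c u == c v) && (c u < y)%N
   then orientation_sum y c ((u, v) |: ((v, u) |: D)) S else 0)%R.
Proof.
elim: S D => [|[p q] S IH] D mono frD.
  rewrite orientation_sum_split //; move: frD => /= /and4P [uv uvD vuD _].
  rewrite big_orients1 // !orientation_sum_nil -setUA.
  have := weight_orient_edge uv uvD vuD.
  (* For different colours only the increasing arrow is admissible, and monotonicity along [D] rules
     out a return path. For equal colours both single arrows are admissible, and the two-way edge is
     missing exactly when the colour is violated. *)
  case: (ltngtP (c u) (c v)) => [lt | lt | /val_inj eq].
  - have -> : (c u == c v) = false by rewrite -val_eqE /= ltn_eqF.
    rewrite /= !addr0 => _; apply: weight_arrow => //.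
    by apply/negP => /(weakly_increasing_connect mono); rewrite leqNgt lt.
  - have -> : (c u == c v) = false by rewrite -val_eqE /= gtn_eqF.
    rewrite /= !addr0 add0r => _; apply: weight_arrow => //.
    by apply/negP => /(weakly_increasing_connect mono); rewrite leqNgt lt.
  rewrite eq eqxx /=; case: (leqP y (c v)) => _ <- /=; first by rewrite ?subr0.
  by rewrite addr0 addrK.
have frS := fresh_swap frD.
have frp : fresh D ((p, q) :: S) := fresh_behead frD.
have frpq Y (oY : orients [:: (p, q)] Y) := fresh_orients frS oY.
have split' D' : fresh D' ((p, q) :: S) ->
    orientation_sum y c D' ((p, q) :: S) =
    (\sum_(Y | admissible y c Y && orients [:: (p, q)] Y)
      orientation_sum y c (Y :|: D') S)%R.
  exact: orientation_sum_split.
(* Exchange the choices on [uv] and [pq], so that [pq] is fixed first. The arrows fixed on [pq] are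
   admissible, so [c] still increases weakly along [Y :|: D] and the induction hypothesis
   applies. *)
rewrite orientation_sum_split // (eq_bigr (fun X => \sum_(Y | admissible y c Y && orients [:: (p, q)] Y) orientation_sum y c (X :|: (Y :|: D)) S)%R); last first.
  move=> X /andP [_ oX]; rewrite split'; last exact: fresh_orients frD _.
  by apply: eq_bigr => Y _; rewrite setUCA.
rewrite exchange_big /= split' //.
under eq_bigr => Y /andP [aY oY].
  rewrite -orientation_sum_split ?frpq // IH ?frpq //; last first.
    move=> a b; rewrite /arrow in_setU => /orP [/(admissibleP _ _ _ aY) [] // | /mono //].
  over.
rewrite sumrB; congr (_ - _)%R.
case: (_ && _); last by rewrite big1_eq.
rewrite split'; last by case/and4P: frD.
by apply: eq_bigr => Y _; rewrite [Y :|: (_ |: _)]setUCA [Y :|: (_ |: _)]setUCA.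
Qed.

End Coloring.

(** * The bivariate chromatic polynomial at negative arguments *)

Definition bad x (y : nat) (c : {ffun V -> 'I_x}) p q : bool :=
  (c p == c q) && (c p < y).

Definition all_bad x (y : nat) (c : {ffun V -> 'I_x}) A : bool :=
  [forall p, forall q, arrow A p q ==> bad y c p q].

Lemma all_badP x y (c : {ffun V -> 'I_x}) A :
  reflect (forall p q, arrow A p q -> bad y c p q) (all_bad y c A).
Proof.
apply: (iffP forallP) => [h p q | h p].
  by have /forallP/(_ q)/implyP := h p.
by apply/forallP => q; apply/implyP/h.
Qed.

Lemma badC x y (c : {ffun V -> 'I_x}) p q : bad y c p q = bad y c q p.
Proof. by rewrite /bad eq_sym; case: eqP => //= ->. Qed.

(** Such a colouring is a free choice of one colour per component of [A]: among [y] colours if the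
    component carries an arrow, among all [x] otherwise. *)
Lemma card_all_bad A : symmetric (arrow A) ->
  exists a b, a + b = n_comp (core A) V /\
    forall x y, y <= x ->
      #|[set c : {ffun V -> 'I_x} | all_bad y c A]| = x ^ a * y ^ b.
Proof.
move=> symA; pose e := core A; have esym : connect_sym e := core_sym A.
have eE p q : e p q = arrow A p q by rewrite /e /core /= symA andbb.
pose I := {v | roots e v}; pose touched v := [exists w, arrow A v w].
have rootI v : roots e (fingraph.root e v) by apply: roots_root.
pose r v : I := Sub (fingraph.root e v) (rootI v).
have rK (i : I) : r (val i) = i by apply: val_inj; apply/eqP/(valP i).
have touched_r v : touched (val (r v)) = touched v.
  rewrite /= ; have /connectP [s + ->] := connect_root e v.
  elim: s v => [//|w s IH] v /= /andP [vw /IH ->].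
  rewrite eE in vw.
  have -> : touched w by apply/existsP; exists v; rewrite symA.
  by symmetry; apply/existsP; exists w.
exists #|[pred i : I | ~~ touched (val i)]|, #|[pred i : I | touched (val i)]|.
split.
  rewrite addnC (cardC [pred i : I | touched (val i)]) card_sig.
  by apply: eq_card => v; rewrite !inE andbT.
move=> x y yx.
(* Colourings are counted through their values at the roots of the components. *)
pose F (i : I) : pred 'I_x := fun k => touched (val i) ==> (k < y).
transitivity #|family F|.
  pose ext (d : {ffun I -> 'I_x}) := [ffun v => d (r v)].
  rewrite -(@card_in_imset _ _ ext (family F)); last first.
    move=> d1 d2 _ _ /ffunP h; apply/ffunP => i.
    by have := h (val i); rewrite !ffunE rK.
  apply: eq_card => c; rewrite inE; apply/all_badP/imsetP => [cA | [d /familyP dF ->] p q pq].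
    have cc p q : connect e p q -> c p = c q.
      case/connectP=> s + ->; elim: s p => [//|w s IH] p /= /andP [pw /IH <-].
      by move: pw; rewrite eE => /cA /andP [/eqP].
    exists [ffun i : I => c (val i)]; last first.
      by apply/ffunP => v; rewrite !ffunE; apply/cc/connect_root.
    apply/familyP => i; rewrite unfold_in ffunE; apply/implyP => /existsP [w].
    by move/cA => /andP [].
  have rpq : r p = r q.
    by apply: val_inj; apply/(fingraph.rootP esym)/connect1; rewrite eE.
  rewrite /bad !ffunE rpq eqxx /=.
  have := dF (r q); rewrite unfold_in touched_r => /implyP; apply.
  by apply/existsP; exists p; rewrite symA.
rewrite card_family foldrE big_map big_enum /= (bigID (fun i : I => touched (val i))) /= mulnC.
rewrite -!prod_nat_const; congr (_ * _); apply: eq_bigr => i.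
  move/negbTE => ti; rewrite -[RHS]card_ord; apply: eq_card => k.
  by rewrite unfold_in ti.
move=> ti; transitivity #|[pred k : 'I_x | k < y]|.
  by apply: eq_card => k; rewrite unfold_in ti.
rewrite -sum1_card -(big_ord_widen _ (fun=> 1) yx).
by rewrite sum1_card card_ord.
Qed.

Lemma PoszX n k : ((n ^ k)%N%:Z = n%:Z ^+ k)%R.
Proof. by elim: k => // k IH; rewrite expnS exprS PoszM IH. Qed.

(** The count and the signed sum satisfy the same recursion on [S]. Both are proved for one
    polynomial, so that the second formula is its value at negative arguments. *)
Lemma bicoloring_poly S A : symmetric (arrow A) -> fresh A S ->
  exists p : {poly {poly int}}, forall x y, 0 < x -> y <= x ->
    p.[x%:Z, y%:Z]%R = #|[set c : {ffun V -> 'I_x} |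
       all_bad y c A && all (fun e => ~~ bad y c e.1 e.2) S]|%:Z%R /\
    p.[- x%:Z, - y%:Z]%R =
      (\sum_(c : {ffun V -> 'I_x} | all_bad y c A) orientation_sum y c A S)%R.
Proof.
elim: S A => [|[u v] S IH] A symA frA.
  have [a [b [ab cardE]]] := card_all_bad symA.
  exists ('X^a * ('X^b)%:P)%R => x y _ yx; split.
    rewrite !hornerE; under eq_finset do rewrite andbT.
    by rewrite cardE // PoszM !PoszX.
  transitivity (weight A *+ #|[set c : {ffun V -> 'I_x} | all_bad y c A]|)%R.
    rewrite cardE // !hornerE /weight.
    have -> : cycles_reversible A by apply/cycles_reversibleP => p q; rewrite symA.
    (* Negating both arguments yields the sign (-1)^(a+b), where a + b is the number of components
       of [A]. *)
    by rewrite -ab -mulr_natr natz PoszM !PoszX exprD (exprNn x%:Z%R) (exprNn y%:Z%R) mulrACA.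
  by rewrite -sumr_const; apply: eq_big => [c|c _]; rewrite ?inE ?orientation_sum_nil.
have symA' : symmetric (arrow ((u, v) |: ((v, u) |: A))).
  by move=> p q; rewrite !arrowU symA orbCA [(q == u) && _]andbC [(q == v) && _]andbC.
have frA' : fresh ((u, v) |: ((v, u) |: A)) S by case/and4P: frA.
have [p hp] := IH _ symA (fresh_behead frA).
have [q hq] := IH _ symA' frA'.
have all_badU x y (c : {ffun V -> 'I_x}) :
    all_bad y c ((u, v) |: ((v, u) |: A)) = all_bad y c A && bad y c u v.
  apply/all_badP/andP => [h | [/all_badP h uv] a b].
    split; last by apply: h; rewrite !arrowU !eqxx.
    by apply/all_badP => a b ab; apply: h; rewrite !arrowU ab !orbT.
  by rewrite !arrowU => /or3P [/andP [/eqP -> /eqP ->]|/andP [/eqP -> /eqP ->]|/h] //; rewrite badC.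
(* Colourings where [uv] is not violated are all those counted without [uv], minus those where [uv]
   is violated. *)
exists (p - q)%R => x y x0 yx.
have [p1 p2] := hp x y x0 yx; have [q1 q2] := hq x y x0 yx.
rewrite !hornerE p1 p2 q1 q2; split.
  apply/eqP; rewrite subr_eq -PoszD; apply/eqP; congr Posz.
  rewrite -cardsUI [X in _ = _ + X]eq_card0 ?addn0; last first.
    by move=> c; rewrite !inE all_badU /=; case: (bad y c u v); rewrite /= ?andbF.
  apply: eq_card => c; rewrite !inE /= all_badU.
  by case: (bad y c u v); case: all_bad; case: all.
under [X in (_ - X)%R]eq_bigl do rewrite all_badU.
rewrite big_mkcondr -sumrB /=; apply: eq_bigr => c /all_badP badA.
(* Violated edges are monochromatic, so [c] is constant along the arrows of [A]. *)
rewrite orientation_sum_cons // => a b /badA /andP [/eqP -> _]; exact: leqnn.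
Qed.

End WeakOrientations.

(** Listing every edge from its lower to its higher end excludes the reversed pair, so no edge
    occurs in both directions. *)
Lemma fresh_ordered (V : finType) (D : {set V * V}) (S : seq (V * V)) :
  uniq S -> all (fun e => enum_rank e.1 < enum_rank e.2) S ->
  (forall p q, (p, q) \in S -> ((p, q) \notin D) && ((q, p) \notin D)) ->
  fresh D S.
Proof.
elim: S D => [//|[u v] S IH] D /= /andP [uvS uS] /andP [uv oS] SD.
have /andP [-> ->] := SD u v (mem_head _ _).
have -> /= : u != v by apply: contraTneq uv => ->; rewrite ltnn.
apply: IH => // p q pqS; have /= pq := allP oS _ pqS.
have := SD p q; rewrite inE pqS orbT => /(_ isT) /andP [pqD qpD].
rewrite !in_setU1 !negb_or pqD qpD !andbT.
have -> : (p, q) != (u, v) by apply: contraNneq uvS => <-.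
have -> : (q, p) != (v, u) by apply: contraNneq uvS => -[<- <-].
rewrite /= andbT; apply/andP; split; apply: contraTneq pq => -[-> ->];
  by rewrite -leqNgt ltnW.
Qed.

(** * Flats formed by the components of the two-way edges *)

Section Components.
Variable G : sgraph.
Implicit Types (X : {set G * G}) (P : {set {set G}}) (u v : G).

Definition component X v : {set G} := [set w | connect (core X) v w].

Definition components X : {set {set G}} := [set component X v | v : G].

Lemma mem_component X v w : (w \in component X v) = connect (core X) v w.
Proof. by rewrite inE. Qed.

Lemma component_eq X u v :
  (component X u == component X v) = connect (core X) u v.
Proof.
apply/eqP/idP => [uv | uv]; first by rewrite -mem_component uv mem_component.
by apply/setP => w; rewrite !mem_component (same_connect (core_sym X) uv).
Qed.

Lemma card_components X : #|components X| = n_comp (core X) G.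
Proof.
rewrite /components; have -> : [set component X v | v : G] =
    [set component X v | v in [set v | roots (core X) v]].
  apply/setP => B; apply/imsetP/imsetP => -[v vr ->]; last by exists v.
  exists (fingraph.root (core X) v); first by rewrite inE roots_root //; apply: core_sym.
  by apply/eqP; rewrite component_eq connect_root.
rewrite card_in_imset => [|u v].
  by apply: eq_card => v; rewrite !inE andbT.
rewrite !inE => /eqP ru /eqP rv /eqP; rewrite component_eq.
by move=> /(fingraph.rootP (core_sym X)); rewrite ru rv.
Qed.

Definition weak_orientation X : bool :=
  cycles_reversible X &&
  [forall u, forall v, (arrow X u v ==> adj u v) && (adj u v ==> arrow X u v || arrow X v u)].

Lemma weak_orientationP X :
  reflect [/\ cycles_reversible X, forall u v, arrow X u v -> adj u v
            & forall u v, adj u v -> arrow X u v || arrow X v u]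
          (weak_orientation X).
Proof.
apply: (iffP andP) => [[crX /forallP h] | [crX h1 h2]]; split=> //.
- by move=> u v; have /forallP/(_ v)/andP [/implyP] := h u.
- by move=> u v; have /forallP/(_ v)/andP [_ /implyP] := h u.
apply/forallP => u; apply/forallP => v.
by apply/andP; split; apply/implyP; [apply: h1 | apply: h2].
Qed.

(** A path of two-way arrows stays in its component and uses edges of [G], so the components are
    connected blocks. *)
Lemma flat_components X : weak_orientation X -> flat (components X).
Proof.
move=> /weak_orientationP [_ sub _]; rewrite flatE; apply/andP; split.
  apply/partitionTP; split.
  - apply/imsetP => -[v _ /setP/(_ v)]; by rewrite mem_component connect0 inE.
  - by move=> v; exists (component X v); rewrite ?imset_f // mem_component connect0.
  - move=> _ _ w /imsetP [u _ ->] /imsetP [v _ ->]; rewrite !mem_component => uw vw.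
    by apply/eqP; rewrite component_eq (connect_trans uw) // core_sym.
apply/forall_inP => _ /imsetP [r _ ->]; apply/forall_inP => u ru.
apply/forall_inP => v rv; move: ru rv; rewrite !mem_component => ru rv.
have : connect (core X) u v by apply: connect_trans rv; rewrite core_sym.
case/connectP => s + ->; elim: s u ru => [|w s IH] u ru /=; first by rewrite connect0.
case/andP => uw ws; have rw : connect (core X) r w := connect_trans ru (connect1 uw).
apply: connect_trans (IH _ rw ws); apply: connect1.
by rewrite /= !mem_component ru rw; case/andP: uw => /sub.
Qed.

End Components.

Lemma bichrom_poly_neg (G : sgraph) (x y : nat) : 0 < x -> y <= x ->
  (bichrom_poly G).[- x%:Z, - y%:Z]%R =
  (\sum_(Xc : {set G * G} * {ffun G -> 'I_x} |
       weak_orientation Xc.1 && admissible y Xc.2 Xc.1)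
     (-1) ^+ #|components Xc.1|)%R.
Proof.
move=> x0 yx.
pose E := [seq e <- enum {: G * G} |
  adj e.1 e.2 && (enum_rank e.1 < enum_rank e.2)].
have memE e : (e \in E) = adj e.1 e.2 && (enum_rank e.1 < enum_rank e.2).
  by rewrite mem_filter mem_enum andbT.
have joinsE u v : joins E u v = adj u v.
  rewrite /joins !memE /= [adj v u]adj_sym -andb_orr.
  case uv: (adj u v) => //=; rewrite -neq_ltn; apply/negP => /eqP /val_inj/enum_rank_inj uvE.
  by rewrite uvE adj_irr in uv.
have frE : fresh set0 E.
  apply: fresh_ordered => [||p q _]; last by rewrite !inE.
    by rewrite filter_uniq // enum_uniq.
  by apply/allP => e; rewrite memE => /andP [].
have sym0 : symmetric (arrow (set0 : {set G * G})) by move=> u v; rewrite /arrow !inE.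
have [p hp] := bicoloring_poly sym0 frE.
have all_bad0 x' y' (c : {ffun G -> 'I_x'}) : all_bad y' c set0.
  by apply/all_badP => u v; rewrite /arrow inE.
(* With no edge required to be violated, [p] counts all bicolorings, and the counting values
   determine the polynomial. *)
have -> : bichrom_poly G = p.
  apply: counts_bicolorings_uniq (@bichrom_polyP G) _ => {x0 yx} {}x {}y x0 yx.
  have [-> _] := hp x y x0 yx; congr Posz; apply: eq_card => c.
  rewrite !inE all_bad0 /=; apply/allP/forallP => [h u | h [u v]].
    apply/forallP => v; apply/implyP; rewrite -joinsE => uv.
    have : ~~ bad y c u v by case/orP: uv => /h //; rewrite badC.
    rewrite /bad /color eqSS -val_eqE /=.
    by case: eqP => //= _; rewrite -leqNgt ltnS.
  move=> uvE; have /forallP/(_ v)/implyP := h u; rewrite -joinsE /joins uvE => /(_ isT).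
  rewrite /bad /color eqSS -val_eqE /=.
  by case: eqP => //= _; rewrite -leqNgt ltnS.
have [_ ->] := hp x y x0 yx.
rewrite (eq_bigl xpredT) => [|c]; last exact: all_bad0.
rewrite /orientation_sum.
(* The sets that are not reversible have weight 0, which leaves the weak orientations. *)
rewrite (exchange_big_dep xpredT) //= pair_big_dep /= big_mkcond [RHS]big_mkcond.
apply: eq_bigr => -[X c] _ /=; rewrite setU0 /weight card_components.
have -> : weak_orientation X = orients E X && cycles_reversible X.
  apply/weak_orientationP/andP => [[crX h1 h2] | [/orientsP [h1 h2] crX]].
    by split=> //; apply/orientsP; split=> u v; rewrite joinsE; [apply: h1 | apply: h2].
  by split=> // u v; rewrite -joinsE; [apply: h1 | apply: h2].
by case: cycles_reversible; rewrite ?andbT ?andbF ?if_same // andbC.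
Qed.

(** * Weak orientations as acyclic orientations of flats *)

Section Quotient.
Variables (G : sgraph) (P : {set {set G}}) (x y : nat).
Hypothesis flatP : flat P.
Local Notation H := (flat_graph P).

Let partP : partition P [set: G].
Proof. by move: flatP; rewrite flatE => /andP []. Qed.

Let pblock_in v : pblock P v \in P.
Proof. by case/and3P: partP => /eqP cP _ _; rewrite pblock_mem // cP. Qed.

Definition block v : H := Sub (pblock P v) (pblock_in v).

Let in_block v (B : H) : (v \in val B) = (block v == B).
Proof.
case/and3P: partP => /eqP cP tP _; apply/idP/eqP => [vB | <-].
  by apply: val_inj; apply: def_pblock (valP B) vB.
by rewrite /= mem_pblock cP.
Qed.

Let in_pblock v u : (v \in pblock P u) = (block v == block u).
Proof. exact: in_block v (block u). Qed.

Let block_surj (B : H) : exists v, block v == B.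
Proof.
case/and3P: partP => _ _ n0; have [B0 | [v]] := set_0Vmem (val B).
  by rewrite -B0 (valP B) in n0.
by rewrite in_block; exists v.
Qed.

Definition representative (B : H) : G := xchoose (block_surj B).

Let block_repr B : block (representative B) = B.
Proof. exact: (eqP (xchooseP (block_surj B))). Qed.

Let components_P X :
  (components X == P) = [forall u, forall v, connect (core X) u v == (block u == block v)].
Proof.
apply/eqP/forallP => [XP u | h].
  apply/forallP => v; rewrite -component_eq -val_eqE /=; apply/eqP.
  have cb w : component X w = pblock P w.
    apply/esym/def_pblock; first by case/and3P: partP.
      by rewrite -XP imset_f.
    by rewrite mem_component connect0.
  by rewrite !cb.
have cb w : component X w = val (block w).
  apply/setP => v; rewrite mem_component in_block eq_sym.
  by have /forallP/(_ v)/eqP := h w.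
apply/setP => B; apply/imsetP/idP => [[v _ ->] | BP]; first by rewrite cb (valP (block v)).
have [v /eqP vB] := block_surj (Sub B BP); exists v => //.
by rewrite cb vB.
Qed.

Let adjE (B C : H) :
  adj B C = (B != C) && [exists u, exists v, [&& block u == B, block v == C & adj u v]].
Proof.
rewrite [LHS]/= /block_adj val_eqE; congr (_ && _).
apply/exists_inP/existsP => -[u].
  rewrite in_block => uB /exists_inP [v vC uv]; exists u; apply/existsP; exists v.
  by move: vC; rewrite in_block uB => ->.
case/existsP => v /and3P [uB vC uv]; exists u; rewrite ?in_block //.
by apply/exists_inP; exists v; rewrite ?in_block.
Qed.

Let contractedP (B : H) u v : block u = B -> block v = B -> u != v -> B \in contracted P.
Proof.
move=> uB vB uv; rewrite inE; apply/card_gt1P; exists u, v.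
by rewrite !in_block uB vB eqxx.
Qed.

Definition lift (oc : {set H * H} * {ffun H -> 'I_x}) : {set G * G} * {ffun G -> 'I_x} :=
  ([set e | adj e.1 e.2 &&
     ((block e.1 == block e.2) || ((block e.1, block e.2) \in oc.1))],
   [ffun v => oc.2 (block v)]).

Let good_quotient (oc : {set H * H} * {ffun H -> 'I_x}) : bool :=
  [&& orientation oc.1, acyclic oc.1, compatible oc.1 oc.2 &
      [forall B in contracted P, y < color (oc.2 B)]].

Let good_weak (Xc : {set G * G} * {ffun G -> 'I_x}) : bool :=
  [&& weak_orientation Xc.1, admissible y Xc.2 Xc.1 & components Xc.1 == P].

Let orientationP (o : {set H * H}) :
  reflect ((forall B C, arrow o B C -> adj B C) /\
           (forall B C, adj B C -> arrow o B C = ~~ arrow o C B)) (orientation o).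
Proof.
apply: (iffP forallP) => [h | [h1 h2] B].
  split=> B C; have /forallP/(_ C) := h B; rewrite -!/(arrow _ _ _); case: (adj B C) => //.
    by case: arrow.
  by move=> + _; case: (arrow o B C); case: (arrow o C B).
apply/forallP => C; rewrite -!/(arrow _ _ _); case BC: (adj B C).
  by rewrite (h2 _ _ BC); case: (arrow o C B).
by apply/negP => /h1; rewrite BC.
Qed.

(** Paths of the lift project to paths of [o], so by acyclicity an arrow on a cycle stays inside a
    block. A two-way edge has two distinct ends in one block, which is therefore contracted and has
    a colour above [y]. *)
Let lift_good oc : good_quotient oc -> good_weak (lift oc).
Proof.
case: oc => o c /and4P /= [/orientationP [osub oor] /forallP acy /forallP comp /forall_inP contr].
rewrite /good_weak /lift /=; set D := [set e | _].
have arrD u v : arrow D u v = adj u v && ((block u == block v) || arrow o (block u) (block v)).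
  by rewrite /arrow inE.
have oconn u v : connect (arrow D) u v -> connect (arrow o) (block u) (block v).
  case/connectP => s + ->; elim: s u => [|w s IH] u /=; first by rewrite connect0.
  case/andP; rewrite arrD => /andP [_ /orP uw] /IH; apply: connect_trans.
  by case: uw => [/eqP -> | /connect1 //]; exact: connect0.
have acyc B C : arrow o B C -> ~~ connect (arrow o) C B.
  by move=> BC; have /forallP/(_ C)/implyP := acy B; apply.
have oasym B C : arrow o B C -> ~~ arrow o C B.
  by move/acyc; apply: contra => /connect1.
have two u v : arrow D u v -> arrow D v u -> block u = block v.
  rewrite !arrD => /andP [_ /predU1P [// | uv]] /andP [_ /predU1P [// | ]].
  by rewrite (negbTE (oasym _ _ uv)).
apply/and3P; split.
- apply/weak_orientationP; split.
  + apply/cycles_reversibleP => u v; rewrite !arrD => /andP [uv /orP [/eqP -> | buv]].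
      by rewrite adj_sym uv eqxx.
    by move=> /oconn; rewrite (negbTE (acyc _ _ buv)).
  + by move=> u v; rewrite arrD => /andP [].
  + move=> u v uv; rewrite !arrD [adj v u]adj_sym uv /= [block v == _]eq_sym.
    have [//|/= buv] := boolP (block u == block v).
    rewrite oor ?orNb // adjE buv; apply/existsP; exists u; apply/existsP; exists v.
    by rewrite !eqxx.
- apply/admissibleP => p q pq; rewrite !ffunE; split.
    move: pq; rewrite arrD => /andP [_ /predU1P [-> // | bpq]].
    by have /forallP/(_ (block q))/implyP/(_ bpq) := comp (block p).
  move=> qp; have bpq := two _ _ pq qp; rewrite -ltnS; apply: contr.
  apply: (@contractedP _ p q) => //; apply/eqP => pqE.
  by move: pq; rewrite arrD pqE adj_irr.
(* Two-way arrows never leave a block; conversely, blocks of a flat are connected and all their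
   edges are two-way. *)
rewrite components_P; apply/forallP => u; apply/forallP => v; apply/eqP; apply/idP/eqP.
  case/connectP => s + ->; elim: s u => [//|w s IH] u /= /andP [/andP [uw wu] /IH <-].
  exact: two.
have : connected_in (pblock P u).
  by move: flatP; rewrite flatE => /andP [_ /forall_inP]; apply.
move=> + buv => /forall_inP/(_ u); rewrite in_pblock eqxx => /(_ isT)/forall_inP/(_ v).
rewrite in_pblock buv eqxx => /(_ isT); apply: connect_sub => a b /= /and3P [].
rewrite !in_pblock => /eqP au /eqP bu ab; apply: connect1.
by rewrite /core /= !arrD [adj b a]adj_sym ab au bu eqxx.
Qed.

(** Any two adjacent blocks are joined by an edge of [G], whose direction in the lift reveals that
    of the quotient edge. *)
Let lift_inj : {in good_quotient &, injective lift}.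
Proof.
move=> [o1 c1] [o2 c2] /and4P /= [/orientationP [s1 _] _ _ _].
move=> /and4P /= [/orientationP [s2 _] _ _ _] [/setP oE /ffunP cE].
congr (_, _); last first.
  by apply/ffunP => B; have := cE (representative B); rewrite !ffunE block_repr.
suff oBC (B C : H) : arrow o1 B C = arrow o2 B C by apply/setP => -[B C]; exact: oBC.
have [BC | nBC] := boolP (adj B C); last by rewrite (contraNF (s1 B C)) // (contraNF (s2 B C)).
move: BC; rewrite adjE => /andP [BC /existsP [u /existsP [v /and3P [/eqP uB /eqP vC uv]]]].
by have := oE (u, v); rewrite !inE /= uv uB vC (negbTE BC).
Qed.

(** The preimage projects the arrows of [X] between distinct blocks. Quotient paths lift to [X]
    because two-way paths connect each block, so a quotient cycle would make its arrows two-way and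
    put their ends in one block. *)
Let lift_surj Xc : good_weak Xc -> exists2 oc, good_quotient oc & lift oc = Xc.
Proof.
case: Xc => X c /and3P /= [/weak_orientationP [/cycles_reversibleP crX Xsub Xor]].
move=> /admissibleP aX; rewrite components_P => /forallP coreP.
have {}coreP u v : connect (core X) u v = (block u == block v).
  by have /forallP/(_ v)/eqP := coreP u.
have core_conn u v : block u = block v -> connect (arrow X) u v.
  move/eqP; rewrite -coreP; apply: connect_sub => a b /andP [ab _]; exact: connect1.
(* The colour weakly increases in both directions of a two-way edge. *)
have cblock u v : block u = block v -> c u = c v.
  move/eqP; rewrite -coreP => /connectP [s + ->].
  elim: s u => [//|w s IH] u /= /andP [/andP [/aX [uw _] /aX [wu _]] /IH <-].
  by apply/val_inj/eqP; rewrite eqn_leq uw wu.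
pose o := [set e : H * H | (e.1 != e.2) &&
  [exists u, exists v, [&& block u == e.1, block v == e.2 & arrow X u v]]].
have arroP B C : reflect (B != C /\ exists u v, [/\ block u = B, block v = C & arrow X u v])
    (arrow o B C).
  rewrite /arrow inE; apply: (iffP andP) => -[BC h]; split=> //.
    by case/existsP: h => u /existsP [v /and3P [/eqP uB /eqP vC uv]]; exists u, v.
  case: h => u [v [<- <- uv]]; apply/existsP; exists u; apply/existsP; exists v.
  by rewrite !eqxx.
have oconn u v : connect (arrow o) (block u) (block v) -> connect (arrow X) u v.
  case/connectP => s; elim: s u => [|B s IH] u /=; first by move=> _ /esym/core_conn.
  case/andP => /arroP [_ [u' [w [u'u wB u'w]]]]; rewrite -wB => ws lv.
  apply: connect_trans (core_conn u u' (esym u'u)) _.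
  by apply: connect_trans (connect1 u'w) _; apply: IH.
have acyc B C : arrow o B C -> ~~ connect (arrow o) C B.
  case/arroP => BC [u [v [uB vC uv]]]; apply: contra BC; rewrite -uB -vC => /oconn vu.
  by rewrite -coreP; apply: connect1; rewrite /core /= uv crX.
pose c' := [ffun B : H => c (representative B)].
have c'E u : c' (block u) = c u by rewrite ffunE; apply: cblock; rewrite block_repr.
exists (o, c'); last first.
  rewrite /lift /=; congr (_, _); last by apply/ffunP => u; rewrite ffunE c'E.
  apply/setP => -[u v]; rewrite inE /= -!/(arrow _ _ _); apply/andP/idP => [[uv] | uv].
    case/orP => [/eqP buv | /arroP [buv [u' [v' [bu bv u'v']]]]].
      by case/orP: (Xor _ _ uv) => // vu; apply: crX vu (core_conn _ _ buv).
    (* If [X] contains [vu], the arrow [u'v'] and paths inside the two blocks close a cycle through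
       it, so [uv] is in [X] as well. *)
    case/orP: (Xor _ _ uv) => // vu; apply: (crX _ _ vu).
    apply: connect_trans (core_conn u u' (esym bu)) _.
    exact: connect_trans (connect1 u'v') (core_conn _ _ bv).
  split; first exact: Xsub.
  have [//|buv] := boolP (block u == block v).
  by apply/arroP; split=> //; exists u, v.
apply/and4P => /=; split.
- apply/orientationP; split=> B C.
    case/arroP => BC [u [v [uB vC uv]]]; rewrite adjE BC; apply/existsP; exists u.
    by apply/existsP; exists v; rewrite uB vC !eqxx Xsub.
  rewrite adjE => /andP [BC /existsP [u /existsP [v /and3P [/eqP uB /eqP vC uv]]]].
  have oor : arrow o B C || arrow o C B.
    case/orP: (Xor _ _ uv) => vu; apply/orP; [left | right]; apply/arroP.
      by split=> //; exists u, v.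
    by rewrite eq_sym; split=> //; exists v, u.
  have := acyc B C; case: (arrow o B C) oor => //= [_ /(_ isT) h | -> //].
  by apply/esym; apply: contra h; apply: connect1.
- apply/forallP => B; apply/forallP => C; apply/implyP; exact: acyc.
- apply/forallP => B; apply/forallP => C; apply/implyP.
  by move=> /arroP [_ [u [v [<- <- uv]]]]; rewrite !c'E /color ltnS; case: (aX _ _ uv).
apply/forall_inP => B; rewrite inE => /card_gt1P [p [q []]]; rewrite !in_block.
move=> /eqP pB /eqP qB pq; rewrite -pB c'E /color ltnS.
have : connect (core X) p q by rewrite coreP pB qB.
(* As [p] and [q] differ, the path has a first step: a two-way edge at [p], which forces the colour
   above [y]. *)
case/connectP => -[|w s] /=; first by move=> _ qE; rewrite qE eqxx in pq.
by case/andP => /andP [pw wp] _ _; have [_] := aX _ _ pw; apply.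
Qed.

Lemma num_acyclic_coloringsE :
  num_acyclic_colorings P x y =
  #|[set Xc : {set G * G} * {ffun G -> 'I_x} |
      [&& weak_orientation Xc.1, admissible y Xc.2 Xc.1 & components Xc.1 == P]]|.
Proof.
rewrite /num_acyclic_colorings -(card_in_imset (f := lift)); last first.
  by move=> oc oc'; rewrite !inE; apply: lift_inj.
apply: eq_card => Xc; rewrite [RHS]inE; apply/imsetP/idP => [[oc] | /lift_surj [oc oc_good <-]].
  by rewrite inE => /lift_good + ->.
by exists oc; rewrite // inE.
Qed.

End Quotient.

Theorem theorem2 (G : sgraph) (x y : nat) (x_ge1 : 1 <= x) (y_le_x : y <= x) :
  (bichrom_poly G).[- x%:Z, - y%:Z]%R =
  (\sum_(P : {set {set G}} | flat P)
     (-1) ^+ #|flat_graph P| * (num_acyclic_colorings P x y)%:Z)%R.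
Proof.
(* Group the weak orientations by the flat that their components form; the sign is constant on each
   group. *)
rewrite bichrom_poly_neg // (partition_big (fun Xc => components Xc.1) (@flat G)) /=; last first.
  by move=> Xc /andP [/flat_components].
apply: eq_bigr => P flatP; rewrite num_acyclic_coloringsE // card_sig.
rewrite (eq_bigr (fun=> (-1) ^+ #|P|)%R) => [|Xc /andP [_ /eqP -> //]].
rewrite -natz mulr_natr -sumr_const; apply: eq_bigl => Xc.
by rewrite inE andbA.
Qed.
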